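(* Let $d\ge1$ and let $\alpha$ be an irrational vector in $\mathbb{R}^d$. Let $A$ be a $d\times d$ integer matrix, let $p,q\in\mathbb{Z}^d$ and $r\in\mathbb{Z}$, be such that the mapping $U:\mathbb{Z}^d\times\mathbb{Z}\to\mathbb{Z}^d\times\mathbb{Z}$, $(m,n)\mapsto(m',n')$, given by $$m' = Am+pn, \qquad n' = \langle q,m\rangle + rn,$$ has non-zero determinant. Then $$\beta = \frac{A\alpha-p}{r-\langle q,\alpha\rangle}, \qquad Tx = Ax+\langle q,x\rangle\beta \quad (x\in\mathbb{R}^d)$$ define an irrational vector $\beta\in\mathbb{R}^d$ and an invertible linear map $T$ on $\mathbb{R}^d$ such that $$T(\mathbb{Z}\alpha+\mathbb{Z}^d)\subset\mathbb{Z}\beta+\mathbb{Z}^d.$$ Conversely, any irrational vector $\beta\in\mathbb{R}^d$ and invertible linear map $T$ on $\mathbb{R}^d$ satisfying $T(\mathbb{Z}\alpha+\mathbb{Z}^d)\subset\mathbb{Z}\beta+\mathbb{Z}^d$ can be obtained in this way, from some such $A,p,q,r$.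
   Context: A vector $\alpha = (\alpha_1,\dots,\alpha_d) \in \mathbb{R}^d$ is called irrational if $1, \alpha_1, \ldots, \alpha_d$ are linearly independent over $\mathbb{Q}$. We write $\mathbb{Z}\alpha+\mathbb{Z}^d = \{ n\alpha + m : n \in \mathbb{Z}, m \in \mathbb{Z}^d\}$, and $\langle\cdot,\cdot\rangle$ for the standard inner product on $\mathbb{R}^d$. The map $U$ is identified with the $(d+1)\times(d+1)$ integer matrix with block form $\begin{pmatrix} A & p\\ q^\top & r\end{pmatrix}$. *)

(* Defs.v *)
From HB Require Import structures.
From mathcomp Require Import all_boot all_order all_algebra.
From mathcomp Require Import classical_sets reals.

Set Implicit Arguments.
Unset Strict Implicit.
Unset Printing Implicit Defensive.

Import Order.TTheory GRing.Theory Num.Theory.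
Local Open Scope classical_set_scope.
Local Open Scope ring_scope.

(* Linear independence of 1, alpha_1, ..., alpha_d over the rationals; c0 is  *)
(* the coefficient of 1.                                                      *)
Definition irrational_vec (R : realType) (d : nat) (alpha : 'cV[R]_d) : Prop :=
  forall (c0 : rat) (c : 'cV[rat]_d),
    ratr c0 + \sum_(i < d) ratr (c i 0) * alpha i 0 = 0 -> c0 = 0 /\ c = 0.

Definition dotp (K : comNzRingType) (d : nat) (u v : 'cV[K]_d) : K :=
  \sum_(i < d) u i 0 * v i 0.

Definition Zspan (R : realType) (d : nat) (alpha : 'cV[R]_d) : set 'cV[R]_d :=
  [set x | exists (n : int) (m : 'cV[int]_d),
             x = n%:~R *: alpha + map_mx intr m].

Definition U_map (d : nat) (A : 'M[int]_d) (p q : 'cV[int]_d) (r : int)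
    (mn : 'cV[int]_d * int) : 'cV[int]_d * int :=
  (A *m mn.1 + mn.2 *: p, dotp q mn.1 + r * mn.2).

Definition U_mx (d : nat) (A : 'M[int]_d) (p q : 'cV[int]_d) (r : int) :
    'M[int]_(d + 1) :=
  block_mx A p q^T r%:M.

Lemma U_mxE (d : nat) (A : 'M[int]_d) (p q : 'cV[int]_d) (r : int)
    (m : 'cV[int]_d) (n : int) :
  U_mx A p q r *m col_mx m n%:M =
  col_mx (U_map A p q r (m, n)).1 (U_map A p q r (m, n)).2%:M.
Proof.
rewrite /U_mx mul_block_col /U_map /= mul_mx_scalar; congr col_mx.
apply/matrixP => i j; rewrite !ord1 -scalar_mxM !mxE eqxx !mulr1n.
by congr (_ + _); apply: eq_bigr => k _; rewrite mxE.
Qed.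

(* Since x / 0 = 0 here, this only has its intended meaning when              *)
(* r - <q, alpha> is non-zero.                                                *)
Definition beta_of (R : realType) (d : nat) (alpha : 'cV[R]_d)
    (A : 'M[int]_d) (p q : 'cV[int]_d) (r : int) : 'cV[R]_d :=
  (r%:~R - dotp (map_mx intr q) alpha)^-1 *:
    (map_mx intr A *m alpha - map_mx intr p).

Definition T_of (R : realType) (d : nat) (A : 'M[int]_d) (q : 'cV[int]_d)
    (beta x : 'cV[R]_d) : 'cV[R]_d :=
  map_mx intr A *m x + dotp (map_mx intr q) x *: beta.

(* Main.v *)
Require Import Defs.
From HB Require Import structures.
From mathcomp Require Import all_boot all_order all_algebra.
From mathcomp Require Import classical_sets reals.

(** Pass to homogeneous coordinates.  Write [lift alpha] for the column
    [(-alpha; 1)] of size [d + 1], and [proj alpha] for the [d x (d + 1)] matrix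
    [(1 | alpha)], which sends [(m; n)] to [m + n alpha]; the kernel of
    [proj alpha] is the line through [lift alpha], and the image of the integer
    vectors under [proj alpha] is [Zalpha + Z^d].  Irrationality of [alpha] says
    that no non-zero rational row annihilates [lift alpha]
    ([irrational_vecP]).

    Let [U] be the block matrix of [A, p, q, r], let [s = r - <q, alpha>] and
    let [B = A + beta q^T] be the matrix of [T].  The relation
    [s beta = A alpha - p] can be read in two ways: [U] maps [lift alpha] to
    [s lift beta] ([U_lift]), and [U] covers [B] along the projections, that is
    [B (proj alpha) = (proj beta) U] ([T_proj]).  The second reading gives the
    inclusion of the lattices at once.

    If [U] is invertible, then [s <> 0], since otherwise the last row of [U]
    would be a rational row annihilating [lift alpha]; a rational row [w] that
    annihilates [lift beta] gives the rational row [w U] annihilating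
    [lift alpha], so [w = 0]; and [B] is injective because [U] takes the kernel
    of [proj alpha] onto that of [proj beta].

    Conversely, the images under [T] of the standard basis vectors and of
    [alpha] are integral combinations of [beta] and the basis vectors; their
    coefficients are the columns of [U].  If [U] were singular it would have a
    non-zero rational vector [v] in its kernel; then [T] kills [proj alpha v],
    so [proj alpha v = 0], which irrationality of [alpha] excludes.  Hence
    [U] is invertible, so [s <> 0], and [beta] is given by the formula. *)

Set Implicit Arguments.
Unset Strict Implicit.
Unset Printing Implicit Defensive.

Import Order.TTheory GRing.Theory Num.Theory.
Local Open Scope classical_set_scope.
Local Open Scope ring_scope.

Section Homogeneous.
Variables (K : fieldType) (d : nat).
Implicit Types (A : 'M[K]_d) (p q alpha beta x : 'cV[K]_d) (r : K).

(** The sign makes [lift alpha] span the kernel of the projection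
    [(m; n) |-> m + n alpha]. *)
Definition lift alpha : 'cV[K]_(d + 1) := col_mx (- alpha) 1%:M.

Definition proj alpha : 'M[K]_(d, d + 1) := row_mx 1%:M alpha.

Lemma dotpE q x : q^T *m x = (dotp q x)%:M.
Proof.
apply/matrixP => i j; rewrite !ord1 !mxE eqxx mulr1n.
by apply: eq_bigr => k _; rewrite mxE.
Qed.

Lemma T_mxE A q beta x :
  (A + beta *m q^T) *m x = A *m x + dotp q x *: beta.
Proof. by rewrite mulmxDl -mulmxA dotpE mul_mx_scalar. Qed.

Lemma U_lift A p q r alpha beta :
  (r - dotp q alpha) *: beta = A *m alpha - p ->
  block_mx A p q^T r%:M *m lift alpha = (r - dotp q alpha) *: lift beta.
Proof.
move=> Hs; rewrite mul_block_col !mulmx1 !mulmxN dotpE scale_col_mx scalerN Hs.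
by rewrite opprB scalemx1 [- _ + p]addrC [- _ + r%:M]addrC -raddfB.
Qed.

Lemma T_proj A p q r alpha beta :
  (r - dotp q alpha) *: beta = A *m alpha - p ->
  (A + beta *m q^T) *m proj alpha = proj beta *m block_mx A p q^T r%:M.
Proof.
move=> Hs; rewrite mul_row_block mul_mx_row !mul1mx mulmx1 T_mxE mul_mx_scalar.
by congr row_mx; rewrite -[A *m alpha](subrK p) -Hs scalerBl addrAC subrK addrC.
Qed.

(** The multiplier is read off the last coordinate, which is [1] in
    [lift beta]. *)
Lemma proj_ker beta (v : 'cV[K]_(d + 1)) :
  proj beta *m v = 0 -> v = dsubmx v 0 0 *: lift beta.
Proof.
rewrite -{1 2}[v]vsubmxK mul_row_col mul1mx [dsubmx v]mx11_scalar mul_mx_scalar.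
move=> /eqP; rewrite addr_eq0 => /eqP ->.
by rewrite scale_col_mx scalerN scalemx1 !mxE eqxx mulr1n.
Qed.

(** Write [B] for the matrix in the conclusion and [U] for the block matrix.  If
    [B x = 0] then [U (x; 0)] lies in the kernel of [proj beta], so it is a
    multiple of [lift beta], hence of [U (lift alpha)]; cancelling [U],
    the vector [(x; 0)] is a multiple of [lift alpha], whose last coordinate is
    [1]. *)
Lemma T_mx_unit A p q r alpha beta :
  (r - dotp q alpha) *: beta = A *m alpha - p ->
  r - dotp q alpha != 0 -> block_mx A p q^T r%:M \in unitmx ->
  A + beta *m q^T \in unitmx.
Proof.
move=> Hs s0 Uu; rewrite -unitmx_tr unitmxE unitfE; apply/negP => /det0P [y y0 By].
set x := y^T; have Bx : (A + beta *m q^T) *m x = 0.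
  by rewrite /x -[_ *m _]trmxK trmx_mul trmxK By trmx0.
have : proj beta *m (block_mx A p q^T r%:M *m col_mx x 0) = 0.
  by rewrite mulmxA -(T_proj Hs) -mulmxA mul_row_col mul1mx mulmx0 addr0.
move/proj_ker; set t := dsubmx _ 0 0 => Ht.
have : col_mx x 0 = (t / (r - dotp q alpha)) *: lift alpha.
  apply: (can_inj (mulKmx Uu)).
  by rewrite -scalemxAr (U_lift Hs) scalerA divfK.
rewrite /lift scale_col_mx => /eq_col_mx [xE /matrixP /(_ 0 0)].
rewrite !mxE eqxx mulr1 => t0.
move: y0; rewrite -[y]trmxK -/x xE -t0 scale0r trmx0.
by rewrite eqxx.
Qed.

End Homogeneous.

Section Columns.
Variables (K : fieldType) (d : nat).

Lemma linear_mulmx (T : 'cV[K]_d -> 'cV[K]_d) :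
  linear T -> forall B : 'M[K]_d,
  (forall j, T (delta_mx j 0) = col j B) -> T =1 mulmx B.
Proof.
move=> linT B HB x.
pose L : {linear 'cV[K]_d -> 'cV[K]_d} :=
  HB.pack T (GRing.isLinear.Build _ _ _ _ T linT).
rewrite -[T]/(L : _ -> _) {1}[x]matrix_sum_delta linear_sum.
rewrite [in RHS](matrix_sum_delta x) mulmx_sumr; apply: eq_bigr => j _.
rewrite !big_ord1 linearZ -scalemxAr /= [T _]HB; congr (_ *: _).
by rewrite colE.
Qed.

Lemma unitmx_bij (B : 'M[K]_d) :
  B \in unitmx -> bijective (fun x : 'cV_d => B *m x).
Proof.
by move=> Bu; exists (mulmx (invmx B)) => x; rewrite ?mulKmx ?mulKVmx.
Qed.

End Columns.

Section Irrational.
Variables (R : realType) (d : nat).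
Implicit Types (alpha beta : 'cV[R]_d) (A : 'M[int]_d) (p q : 'cV[int]_d).

(** The row [(-c, c0)] applied to [lift alpha] is [c0 + <c, alpha>]. *)
Lemma irrational_vecP alpha :
  irrational_vec alpha <->
  forall w : 'rV[rat]_(d + 1), map_mx ratr w *m lift alpha = 0 -> w = 0.
Proof.
have E (c0 : rat) (c : 'cV[rat]_d) :
    map_mx ratr (row_mx (- c^T) c0%:M) *m lift alpha =
    (ratr c0 + \sum_(i < d) ratr (c i 0) * alpha i 0)%:M.
  rewrite map_row_mx mul_row_col map_mxN mulNmx mulmxN opprK mulmx1 map_scalar_mx.
  rewrite -map_trmx dotpE addrC -raddfD; congr (_ + _)%:M.
  by apply: eq_bigr => i _; rewrite mxE.
split=> [irr w|irr c0 c e0].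
  have -> : w = row_mx (- (- (lsubmx w)^T)^T) (rsubmx w 0 0)%:M.
    by rewrite raddfN /= trmxK opprK -mx11_scalar hsubmxK.
  rewrite E => /matrixP /(_ 0 0); rewrite !mxE eqxx mulr1n => /irr [-> ->].
  by rewrite trmx0 oppr0 [0%:M]raddf0 row_mx0.
have := irr (row_mx (- c^T) c0%:M); rewrite E e0 => /(_ (raddf0 _)).
rewrite -row_mx0 => /eq_row_mx [c0' /matrixP /(_ 0 0)].
rewrite !mxE eqxx mulr1n => ->; split=> //.
by rewrite -[c]trmxK -[c^T]opprK c0' oppr0 trmx0.
Qed.

Lemma map_intr_ratr m n (M : 'M[int]_(m, n)) :
  map_mx intr M = map_mx ratr (map_mx intr M : 'M[rat]_(m, n)) :> 'M[R]_(m, n).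
Proof. by apply/matrixP => i j; rewrite !mxE ratr_int. Qed.

Lemma map_U_mx (K : fieldType) A p q r :
  map_mx intr (U_mx A p q r) =
  block_mx (map_mx intr A) (map_mx intr p) (map_mx intr q)^T r%:~R%:M
  :> 'M[K]_(d + 1).
Proof. by rewrite /U_mx map_block_mx map_scalar_mx map_trmx. Qed.

Lemma map_intr_unitmx (K : numFieldType) n (M : 'M[int]_n) :
  \det M != 0 -> (map_mx intr M : 'M[K]_n) \in unitmx.
Proof. by move=> M0; rewrite unitmxE unitfE det_map_mx intr_eq0. Qed.

(** The scalar [r - <q, alpha>] is the last row of [U] applied to
    [lift alpha]; that row is non-zero when [U] is invertible. *)
Lemma denominator_neq0 alpha A p q r :
  irrational_vec alpha -> \det (U_mx A p q r) != 0 ->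
  r%:~R - dotp (map_mx intr q) alpha != 0.
Proof.
move=> /irrational_vecP irr U0; apply/negP => /eqP s0.
pose w : 'rV[rat]_(d + 1) := row_mx 0 1%:M.
have wU0 : w *m map_mx intr (U_mx A p q r) = 0.
  apply: irr; rewrite map_mxM -map_intr_ratr map_row_mx map_mx0 map_mx1.
  rewrite map_U_mx mul_row_block !mul0mx !add0r !mul1mx mul_row_col mulmx1.
  by rewrite mulmxN dotpE addrC -raddfB s0 raddf0.
have := mulmxK (map_intr_unitmx rat U0) w; rewrite wU0 mul0mx -row_mx0.
move=> /eq_row_mx [_ /matrixP /(_ 0 0)]; rewrite !mxE => /eqP.
by rewrite eq_sym oner_eq0.
Qed.

(** A rational row [w] annihilating [lift beta] pulls back along [U] to the
    rational row [w U] annihilating [lift alpha]. *)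
Lemma irrational_beta alpha beta A p q r :
  irrational_vec alpha -> \det (U_mx A p q r) != 0 ->
  (r%:~R - dotp (map_mx intr q) alpha) *: beta =
    map_mx intr A *m alpha - map_mx intr p ->
  irrational_vec beta.
Proof.
move=> /irrational_vecP irr U0 Hs; apply/irrational_vecP => w w0.
have Uu := map_intr_unitmx rat U0.
rewrite -(mulmxK Uu w) [w *m _]irr ?mul0mx // map_mxM -map_intr_ratr map_U_mx.
by rewrite -mulmxA (U_lift Hs) -scalemxAr w0 scaler0.
Qed.

(** A rational relation [m + n alpha = 0] between vectors gives, in each
    coordinate, a rational relation between [1] and one [alpha i]; some
    coordinate exists because [d > 0]. *)
Lemma proj_rat_inj alpha (v : 'cV[rat]_(d + 1)) :
  (0 < d)%N -> irrational_vec alpha -> proj alpha *m map_mx ratr v = 0 -> v = 0.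
Proof.
move=> d0 irr; rewrite -[v]vsubmxK map_col_mx mul_row_col mul1mx.
rewrite [dsubmx v]mx11_scalar map_scalar_mx mul_mx_scalar => E.
have coord i : usubmx v i 0 = 0 /\ dsubmx v 0 0 = 0.
  have [|-> /matrixP /(_ i 0)] := irr (usubmx v i 0) (dsubmx v 0 0 *: delta_mx i 0).
    move/matrixP/(_ i 0): E; rewrite !mxE => E; rewrite -[RHS]E; congr (_ + _).
    rewrite (bigD1 i) //= big1 => [|j ji]; rewrite !mxE ?eqxx ?mulr1 ?addr0 //.
    by rewrite (negPf ji) mulr0 rmorph0 mul0r.
  by rewrite !mxE !eqxx mulr1.
have -> : usubmx v = 0
  by apply/matrixP => i j; rewrite ord1 [RHS]mxE; case: (coord i).
by have [_ ->] := coord (Ordinal d0); rewrite raddf0 col_mx0.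
Qed.

(** Call [B] the matrix in the last hypothesis.  It is injective over the reals
    and [proj alpha] is injective on rational vectors, so
    [B (proj alpha) = (proj beta) U] prevents [U] from killing a non-zero
    rational vector. *)
Lemma det_U_neq0 alpha beta A p q r :
  (0 < d)%N -> irrational_vec alpha ->
  (r%:~R - dotp (map_mx intr q) alpha) *: beta =
    map_mx intr A *m alpha - map_mx intr p ->
  injective (mulmx (map_mx intr A + beta *m (map_mx intr q)^T) : 'cV_d -> 'cV_d) ->
  \det (U_mx A p q r) != 0.
Proof.
move=> d0 irr Hs injB; rewrite -(intr_eq0 rat) -det_map_mx -det_tr.
apply/negP => /det0P [v v0 vU].
have Uv : map_mx intr (U_mx A p q r) *m v^T = 0.
  by rewrite -[LHS]trmxK trmx_mul trmxK vU trmx0.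
suff v'0 : v^T = 0 by rewrite -[v]trmxK v'0 trmx0 eqxx in v0.
apply: (proj_rat_inj d0 irr); apply: injB.
rewrite mulmx0 mulmxA (T_proj Hs) -map_U_mx -mulmxA map_intr_ratr.
by rewrite -map_mxM Uv map_mx0 mulmx0.
Qed.

Lemma ZspanP beta x :
  Zspan beta x <-> exists v : 'cV[int]_(d + 1), x = proj beta *m map_mx intr v.
Proof.
split=> [[n [m ->]]|[v ->]].
  exists (col_mx m n%:M).
  by rewrite map_col_mx mul_row_col mul1mx map_scalar_mx mul_mx_scalar addrC.
exists (dsubmx v 0 0), (usubmx v).
rewrite -{1}[v]vsubmxK map_col_mx mul_row_col mul1mx.
by rewrite {1}[dsubmx v]mx11_scalar map_scalar_mx mul_mx_scalar addrC.
Qed.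

End Irrational.

Theorem theorem6p1 (R : realType) (d : nat) (hd : (0 < d)%N)
    (alpha : 'cV[R]_d) (halpha : irrational_vec alpha) :
  (forall (A : 'M[int]_d) (p q : 'cV[int]_d) (r : int),
     \det (U_mx A p q r) != 0 ->
     let beta := beta_of alpha A p q r in
     let T := T_of A q beta in
     [/\ r%:~R - dotp (map_mx intr q) alpha != 0,
         irrational_vec beta,
         linear T,
         bijective T
       & T @` Zspan alpha `<=` Zspan beta])
  /\
  (forall (beta : 'cV[R]_d) (T : 'cV[R]_d -> 'cV[R]_d),
     irrational_vec beta -> linear T -> bijective T ->
     T @` Zspan alpha `<=` Zspan beta ->
     exists (A : 'M[int]_d) (p q : 'cV[int]_d) (r : int),
       [/\ \det (U_mx A p q r) != 0,
           r%:~R - dotp (map_mx intr q) alpha != 0,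
           beta = beta_of alpha A p q r
         & forall x : 'cV[R]_d, T x = T_of A q beta x]).
Proof.
split=> [A p q r U0 beta T|beta T _ linT bijT subT].
  have s0 := denominator_neq0 halpha U0.
  have Hs : (r%:~R - dotp (map_mx intr q) alpha) *: beta =
      map_mx intr A *m alpha - map_mx intr p by rewrite scalerA divff ?scale1r.
  have TE : mulmx (map_mx intr A + beta *m (map_mx intr q)^T) =1 T.
    by move=> x; rewrite T_mxE.
  split=> //.
  - exact: irrational_beta halpha U0 Hs.
  - by move=> a x y; rewrite -!TE linearP.
  - apply: (eq_bij (unitmx_bij _) TE); apply: T_mx_unit Hs s0 _.
    by rewrite -map_U_mx map_intr_unitmx.
  - move=> _ [x /ZspanP [v ->] <-]; apply/ZspanP; exists (U_mx A p q r *m v).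
    by rewrite -TE mulmxA (T_proj Hs) -map_U_mx map_mxM mulmxA.
(* Membership of [T alpha] in the lattice of [beta] yields [p, r]; that of the
   images of the standard basis vectors yields the columns of [A] and [q]. *)
have [r [p TalphaE]] : Zspan beta (T alpha).
  apply: subT; exists alpha => //; exists 1, 0.
  by rewrite scale1r map_mx0 addr0.
have /fin_all_exists [n /fin_all_exists [m TdeltaE]] (j : 'I_d) :
    Zspan beta (T (delta_mx j 0)).
  apply: subT; exists (delta_mx j 0) => //; exists 0, (delta_mx j 0).
  by rewrite scale0r add0r map_delta_mx.
pose A : 'M[int]_d := \matrix_(i, j) m j i 0.
pose q : 'cV[int]_d := \col_j n j.
have TE : T =1 mulmx (map_mx intr A + beta *m (map_mx intr q)^T).
  apply: linear_mulmx => // j; rewrite TdeltaE; apply/matrixP => i k.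
  by rewrite ord1 !mxE big_ord1 !mxE addrC mulrC.
(* Evaluate [T alpha] twice: as [r beta + p], and as [A alpha + <q, alpha> beta]. *)
have Hs : (r%:~R - dotp (map_mx intr q) alpha) *: beta =
    map_mx intr A *m alpha - map_mx intr p.
  apply/eqP; rewrite scalerBl subr_eq addrAC eq_sym subr_eq -TalphaE TE.
  by rewrite T_mxE.
have U0 : \det (U_mx A p q r) != 0.
  by apply: det_U_neq0 Hs _ => //; apply: eq_inj TE; exact: bij_inj.
have s0 := denominator_neq0 halpha U0.
exists A, p, q, r; split=> // [|x]; last by rewrite TE T_mxE.
by rewrite /beta_of -Hs scalerA mulVf ?scale1r.
Qed.
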